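(* Let $A|H$ and $B|K$ be conditional events. Then, with conjunction and disjunction understood as conditional random quantities in the setting of coherence, $$\mathbb{P}[(A|H)\wedge(B|K)]\le P(A|H)\le\mathbb{P}[(A|H)\vee(B|K)],$$ and moreover $$(A|H)\wedge(B|K)\le A|H\le(A|H)\vee(B|K)$$ (as inequalities between random quantities, i.e. in every case). The same inequalities hold with $B|K$ in place of $A|H$ in the middle term.
   Context: Events are elements of a Boolean algebra, $\overline{E}$ is negation, juxtaposition is conjunction, and an event is identified with its $\{0,1\}$-valued indicator; $\mathbb{P}$ denotes prevision. Conditioning events are not impossible. For a random quantity $X$ with finitely many values, an event $H\neq\emptyset$ and an assessed prevision $\mu=\mathbb{P}(X|H)$, the conditional random quantity is $X|H=XH+\mu\overline{H}$. In particular the indicator of a conditional event is $A|H=AH+x\overline{H}$ with $x=P(A|H)$. Coherence: an assessment $(\mu_1,\ldots,\mu_n)$ on conditional random quantities $X_1|H_1,\ldots,X_n|H_n$ is coherent if for every nonempty $J\subseteq\{1,\ldots,n\}$ and all real $s_i$ $(i\in J)$, the values of $G=\sum_{i\in J}s_iH_i(X_i-\mu_i)$ restricted to $\bigvee_{i\in J}H_i$ satisfy $\min G\le 0\le\max G$. The assessment on $\{A|H,\ B|K,\ (A|H)\wedge(B|K),\ (A|H)\vee(B|K)\}$ is assumed coherent. Conjunction: given $x=P(A|H)$ and $y=P(B|K)$, $(A|H)\wedge(B|K)=(AHBK+x\,\overline{H}BK+y\,AH\overline{K})\,|\,(H\vee K)$, so its value on $\overline{H}\,\overline{K}$ is its prevision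 $\mathbb{P}[(A|H)\wedge(B|K)]$. Disjunction: $(A|H)\vee(B|K)=((AH\vee BK)+x\,\overline{H}\,\overline{B}K+y\,\overline{A}H\overline{K})\,|\,(H\vee K)$, so its value on $\overline{H}\,\overline{K}$ is its prevision $\mathbb{P}[(A|H)\vee(B|K)]$. *)

(* Defs.v *)
From HB Require Import structures.
From mathcomp Require Import all_boot all_order all_algebra.
From mathcomp Require Import boolp classical_sets functions cardinality reals.

Set Implicit Arguments.
Unset Strict Implicit.
Unset Printing Implicit Defensive.

Import Order.Theory GRing.Theory Num.Theory.
Local Open Scope classical_set_scope.
Local Open Scope ring_scope.

Section Coherence.
Context (d : Order.disp_t) (L : ctbDistrLatticeType d) (R : realType).

(* The events are the elements of an arbitrary Boolean algebra L.  A possible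
   case is a truth assignment to all the events that respects the Boolean
   operations: a Boolean homomorphism from L to {false, true}, i.e. a point of
   the Stone space of L; every event different from \bot is true in some case.
   The structure {tblmorphism L -> bool} is not used because it only requires
   \bot and \top to be preserved. *)
Record possible_case := PossibleCase {
  truth :> L -> bool;
  case_meet : forall E F : L, truth (E `&` F)%O = truth E && truth F;
  case_join : forall E F : L, truth (E `|` F)%O = truth E || truth F;
  case_compl : forall E : L, truth (~` E)%O = ~~ truth E
}.

Lemma case_bot (w : possible_case) : w \bot%O = false.
Proof. by rewrite -(meetxC \bot%O) case_meet case_compl andbN. Qed.

Lemma case_top (w : possible_case) : w \top%O = true.
Proof. by rewrite -(joinxC \top%O) case_join case_compl orbN. Qed.

(* A random quantity takes finitely many values and, for each real v, X = v is
   an event. *)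
Definition is_quantity (X : possible_case -> R) : Prop :=
  finite_set (range X) /\
  forall v : R, exists E : L, forall w : possible_case, w E = (X w == v).

Record random_quantity := Quantity {
  value :> possible_case -> R;
  valueP : is_quantity value
}.

Definition ind (E : L) : possible_case -> R := fun w => (w E)%:R.

Lemma quantity_cst (c : R) : is_quantity (fun=> c).
Proof.
split; first by apply: (sub_finite_set _ (finite_set1 c)) => _ [w _ <-].
move=> v; case: (eqVneq c v) => _; [exists \top%O | exists \bot%O] => w.
  by rewrite case_top.
by rewrite case_bot.
Qed.

Lemma quantity_ind (E : L) : is_quantity (ind E).
Proof.
split.
  apply: (sub_finite_set _ (finite_set2 (0 : R) 1)) => _ [w _ <-].
  by rewrite /ind; case: (w E); [right | left].
move=> v; case: (eqVneq v 1) => [->|v1].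
  by exists E => w; rewrite /ind; case: (w E); rewrite ?eqxx // eq_sym oner_eq0.
case: (eqVneq v 0) => [->|v0].
  exists (~` E)%O => w; rewrite /ind case_compl.
  by case: (w E); rewrite ?eqxx ?oner_eq0.
exists \bot%O => w; rewrite case_bot /ind.
by case: (w E); rewrite eq_sym ?(negbTE v1) ?(negbTE v0).
Qed.

Lemma quantity_op (f : R -> R -> R) (X Y : possible_case -> R) :
  is_quantity X -> is_quantity Y -> is_quantity (fun w => f (X w) (Y w)).
Proof.
move=> [fX eX] [fY eY]; split; first exact: finite_image11.
move=> v; have [EX hX] := choice eX; have [EY hY] := choice eY.
have /finite_seqP[s hs] := fX; have /finite_seqP[r hr] := fY.
exists (\join_(a <- s) \join_(b <- r | f a b == v) (EX a `&` EY b))%O => w.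
have join_has (I : Type) (t : seq I) (P : pred I) (F : I -> L) :
    w (\join_(i <- t | P i) F i)%O = has (fun i => P i && w (F i)) t.
  elim: t => [|i t IH]; first by rewrite big_nil case_bot.
  by rewrite big_cons /=; case: (P i) => //=; rewrite case_join IH.
rewrite join_has; apply/hasP/eqP => [[a _]|fv].
  rewrite /= join_has => /hasP[b _ /andP[/eqP <-]].
  by rewrite case_meet hX hY => /andP[/eqP -> /eqP ->].
have Xs : X w \in s by have : range X (X w) by []; rewrite hs.
have Yr : Y w \in r by have : range Y (Y w) by []; rewrite hr.
exists (X w) => //=; rewrite join_has; apply/hasP; exists (Y w) => //.
by rewrite fv eqxx case_meet hX hY !eqxx.
Qed.

Definition indicator (E : L) : random_quantity := Quantity (quantity_ind E).

Record assessed := Assessed {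
  quantity : random_quantity;
  given : L;
  prevision : R
}.

Definition conditional (a : assessed) : possible_case -> R := fun w =>
  quantity a w * ind (given a) w + prevision a * ind (~` given a)%O w.

Definition gain (n : nat) (a : n.-tuple assessed) (J : {set 'I_n})
    (s : 'I_n -> R) : possible_case -> R := fun w =>
  \sum_(i in J) s i * ind (given (tnth a i)) w
                * (quantity (tnth a i) w - prevision (tnth a i)).

Definition is_min (V : set R) (m : R) : Prop := V m /\ lbound V m.
Definition is_max (V : set R) (m : R) : Prop := V m /\ ubound V m.

Definition coherent (n : nat) (a : n.-tuple assessed) : Prop :=
  forall (J : {set 'I_n}) (s : 'I_n -> R), J != finset.set0 ->
  let V := gain a J s @`
    [set w : possible_case | w (\join_(i in J) given (tnth a i))%O] in
  exists m M : R, [/\ is_min V m, is_max V M & m <= 0 <= M].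

(* The conditional event A|H with x = P(A|H). *)
Definition cond_event (A H : L) (x : R) : assessed :=
  Assessed (indicator A) H x.

Definition conj_value (A H B K : L) (x y : R) : possible_case -> R := fun w =>
  ind (A `&` H `&` B `&` K)%O w
  + x * ind (~` H `&` B `&` K)%O w
  + y * ind (A `&` H `&` ~` K)%O w.

Definition disj_value (A H B K : L) (x y : R) : possible_case -> R := fun w =>
  ind ((A `&` H) `|` (B `&` K))%O w
  + x * ind (~` H `&` ~` B `&` K)%O w
  + y * ind (~` A `&` H `&` ~` K)%O w.

Lemma quantity_comb (E F G : L) (x y : R) :
  is_quantity (fun w => ind E w + x * ind F w + y * ind G w).
Proof.
apply: (@quantity_op +%R); last first.
  exact: (@quantity_op *%R _ _ (quantity_cst y) (quantity_ind G)).
apply: (@quantity_op +%R); first exact: quantity_ind.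
exact: (@quantity_op *%R _ _ (quantity_cst x) (quantity_ind F)).
Qed.

(* (A|H) /\ (B|K) and (A|H) \/ (B|K), where x = P(A|H) and y = P(B|K), with
   their own assessed previsions z and t. *)
Definition conjunction (A H B K : L) (x y z : R) : assessed :=
  Assessed (@Quantity (conj_value A H B K x y) (quantity_comb _ _ _ _ _))
           (H `|` K)%O z.

Definition disjunction (A H B K : L) (x y t : R) : assessed :=
  Assessed (@Quantity (disj_value A H B K x y) (quantity_comb _ _ _ _ _))
           (H `|` K)%O t.

End Coherence.

(* Main.v *)
Require Import Defs.
From HB Require Import structures.
From mathcomp Require Import all_boot all_order all_algebra.
From mathcomp Require Import boolp classical_sets functions cardinality reals.
From mathcomp Require Import lra.
Import Order.Theory GRing.Theory Num.Theory.
Local Open Scope ring_scope.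

(** Coherence makes previsions monotone: if one conditional random quantity is
    at most another in every case where one of the two conditioning events is
    true, then buying the larger and selling the smaller at their assessed
    prices gains at least the price received minus the price paid, which
    therefore cannot be positive ([coherent_prevision_le]).  The same argument with a
    single bet shows that [x = P(A|H)] and [y = P(B|K)] lie between 0 and 1.

    With [x] and [y] in the unit interval, inspection of the truth values of
    [A], [H], [B] and [K] gives conjunction <= A|H <= disjunction wherever
    [H \/ K] is true ([conjunction_le], [le_disjunction]).  Monotonicity then
    yields [z <= x <= t].  In the remaining cases, where [H] and [K] are both
    false, the three quantities equal [z], [x] and [t], so the pointwise
    inequality there is the one just obtained between previsions.  Exchanging
    the two conditional events leaves the conjunction and the disjunction
    unchanged, which gives the inequalities for [B|K]. *)

Section CoherentAssessment.
Context (d : Order.disp_t) (L : ctbDistrLatticeType d) (R : realType).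
Implicit Types (w : possible_case L) (b : assessed L R).

Lemma case_bigjoin w (I : Type) (r : seq I) (P : pred I) (F : I -> L) :
  w (\join_(i <- r | P i) F i)%O = has (fun i => P i && w (F i)) r.
Proof.
elim: r => [|i r IH]; first by rewrite big_nil case_bot.
by rewrite big_cons /=; case: (P i) => //=; rewrite case_join IH.
Qed.

Lemma given_gain b w :
  ind R (given b) w * (quantity b w - prevision b)
  = conditional b w - prevision b.
Proof. by rewrite /conditional /ind case_compl; case: (w _) => /=; lra. Qed.

Lemma gainE n (a : n.-tuple (assessed L R)) J s w :
  gain a J s w
  = \sum_(i in J) s i * (conditional (tnth a i) w - prevision (tnth a i)).
Proof. by apply: eq_bigr => i _; rewrite -mulrA given_gain. Qed.

Section Coherent.
Context (n : nat) (a : n.-tuple (assessed L R)) (coh : coherent a).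

(** No coherent bet has a sure gain: a uniform lower bound of the gain is below
    its minimum, which is at most zero. *)
Lemma coherent_gain_lb (J : {set 'I_n}) (s : 'I_n -> R) (c : R) :
    J != finset.set0 ->
    (forall w, (exists2 i, i \in J & w (given (tnth a i))) ->
       c <= gain a J s w) ->
  c <= 0.
Proof.
move=> J0 lbc; have [m [M [[[w wJ <-] _] _ /andP[m0 _]]]] := coh J s J0.
apply: le_trans m0; apply: lbc; move: wJ => /=; rewrite case_bigjoin.
by move=> /hasP[i _ /andP[iJ wi]]; exists i.
Qed.

Lemma coherent_prevision_le (i j : 'I_n) :
    (forall w, w (given (tnth a i)) || w (given (tnth a j)) ->
       conditional (tnth a i) w <= conditional (tnth a j) w) ->
  prevision (tnth a i) <= prevision (tnth a j).
Proof.
have [->//|ij] := eqVneq i j => le_ij; rewrite -subr_le0.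
apply: (@coherent_gain_lb [set i; j]%SET (fun k => if k == j then 1 else -1)).
  by apply/finset.set0Pn; exists i; rewrite !inE eqxx.
move=> w [k kJ wk]; rewrite gainE big_setU1 ?inE //= big_set1 eqxx (negbTE ij).
suff: conditional (tnth a i) w <= conditional (tnth a j) w by lra.
by apply: le_ij; move: kJ wk; rewrite !inE => /orP[] /eqP -> ->; rewrite ?orbT.
Qed.

Lemma coherent_prevision_itv (i : 'I_n) (l u : R) :
    (forall w, w (given (tnth a i)) -> l <= quantity (tnth a i) w <= u) ->
  l <= prevision (tnth a i) <= u.
Proof.
move=> lXu; have J0 : [set i]%SET != finset.set0.
  by apply/finset.set0Pn; exists i; rewrite inE.
(* A unit purchase bounds the prevision below, a unit sale bounds it above. *)
apply/andP; split; rewrite -subr_le0.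
- apply: (@coherent_gain_lb _ (fun=> 1) _ J0) => w [_ /set1P -> wi].
  by rewrite /gain big_set1 /ind wi; have := lXu w wi => /=; lra.
- apply: (@coherent_gain_lb _ (fun=> -1) _ J0) => w [_ /set1P -> wi].
  by rewrite /gain big_set1 /ind wi; have := lXu w wi => /=; lra.
Qed.

End Coherent.

Section Compound.
Context (A H B K : L) (x y : R).

Lemma indicator_itv (E : L) w : 0 <= indicator R E w <= 1.
Proof. by rewrite /= /ind; case: (w E); rewrite lexx ler01. Qed.

Lemma conjunctionC z w :
  conditional (conjunction A H B K x y z) w
  = conditional (conjunction B K A H y x z) w.
Proof.
rewrite /conditional /= /conj_value /ind.
rewrite !(case_compl, case_join, case_meet).
by case: (w A); case: (w H); case: (w B); case: (w K) => /=; lra.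
Qed.

Lemma disjunctionC t w :
  conditional (disjunction A H B K x y t) w
  = conditional (disjunction B K A H y x t) w.
Proof.
rewrite /conditional /= /disj_value /ind.
rewrite !(case_compl, case_join, case_meet).
by case: (w A); case: (w H); case: (w B); case: (w K) => /=; lra.
Qed.

Hypotheses (x01 : 0 <= x <= 1) (y01 : 0 <= y <= 1).

(** Where [H] is true, the conjunction is 0 if [A] fails and otherwise 1, [y]
    or 0; where [H] is false and [K] true, it is [x] or 0 while [A|H] is [x]. *)
Lemma conjunction_le z w : w H || w K ->
  conditional (conjunction A H B K x y z) w
  <= conditional (cond_event A H x) w.
Proof.
rewrite /conditional /= /conj_value /ind.
rewrite !(case_compl, case_join, case_meet).
move: x01 y01; case: (w A); case: (w H); case: (w B); case: (w K) => //= ? ? _; lra.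
Qed.

(** Where [H] is true, the disjunction is 1 if [A] holds and otherwise
    nonnegative; where [H] is false and [K] true, it is 1 or [x] while [A|H]
    is [x]. *)
Lemma le_disjunction t w : w H || w K ->
  conditional (cond_event A H x) w
  <= conditional (disjunction A H B K x y t) w.
Proof.
rewrite /conditional /= /disj_value /ind.
rewrite !(case_compl, case_join, case_meet).
move: x01 y01; case: (w A); case: (w H); case: (w B); case: (w K) => //= ? ? _; lra.
Qed.

Lemma cond_event_between z t w : z <= x <= t ->
  conditional (conjunction A H B K x y z) w
    <= conditional (cond_event A H x) w
    <= conditional (disjunction A H B K x y t) w.
Proof.
move=> zxt; have [HK|] := boolP (w H || w K).
  by rewrite conjunction_le ?le_disjunction.
rewrite negb_or => /andP[/negbTE wH /negbTE wK].
rewrite /conditional /ind /= !case_compl !case_join wH wK /=; lra.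
Qed.

End Compound.
End CoherentAssessment.

Theorem mainTheorem6 (d : Order.disp_t) (L : ctbDistrLatticeType d) (R : realType)
    (A H B K : L) (x y z t : R) (H0 : H != \bot%O) (K0 : K != \bot%O)
    (coh : coherent [tuple cond_event A H x; cond_event B K y;
                           conjunction A H B K x y z;
                           disjunction A H B K x y t]) :
  [/\ z <= x <= t,
      forall w : possible_case L,
        conditional (conjunction A H B K x y z) w
          <= conditional (cond_event A H x) w
          <= conditional (disjunction A H B K x y t) w,
      z <= y <= t
    & forall w : possible_case L,
        conditional (conjunction A H B K x y z) w
          <= conditional (cond_event B K y) w
          <= conditional (disjunction A H B K x y t) w].
Proof.
pose iA : 'I_4 := @Ordinal 4 0 isT; pose iB : 'I_4 := @Ordinal 4 1 isT.
pose iC : 'I_4 := @Ordinal 4 2 isT; pose iD : 'I_4 := @Ordinal 4 3 isT.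
have x01 : 0 <= x <= 1.
  exact: (@coherent_prevision_itv _ _ _ _ _ coh iA _ _ (fun w _ => @indicator_itv _ _ _ A w)).
have y01 : 0 <= y <= 1.
  exact: (@coherent_prevision_itv _ _ _ _ _ coh iB _ _ (fun w _ => @indicator_itv _ _ _ B w)).
have zxt : z <= x <= t.
  apply/andP; split.
  - apply: (@coherent_prevision_le _ _ _ _ _ coh iC iA) => w wHK.
    apply: conjunction_le => //; move: wHK; rewrite /tnth /= case_join.
    by case: (w H); case: (w K).
  - apply: (@coherent_prevision_le _ _ _ _ _ coh iA iD) => w wHK.
    apply: le_disjunction => //; move: wHK; rewrite /tnth /= case_join.
    by case: (w H); case: (w K).
have zyt : z <= y <= t.
  apply/andP; split.
  - apply: (@coherent_prevision_le _ _ _ _ _ coh iC iB) => w wHK.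
    rewrite [leLHS]conjunctionC.
    apply: conjunction_le => //; move: wHK; rewrite /tnth /= case_join.
    by case: (w H); case: (w K).
  - apply: (@coherent_prevision_le _ _ _ _ _ coh iB iD) => w wHK.
    rewrite [leRHS]disjunctionC.
    apply: le_disjunction => //; move: wHK; rewrite /tnth /= case_join.
    by case: (w H); case: (w K).
split=> // w; first exact: cond_event_between.
by rewrite conjunctionC disjunctionC; apply: cond_event_between.
Qed.
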